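(* Let $\mathcal H$ be a real Hilbert space and let $F\colon\mathcal H\to\mathcal H$ be $L$-Lipschitz continuous and $\alpha$-strongly monotone. Let $I:=\{1,\ldots,m\}$, let $C_i\subseteq\mathcal H$, $i\in I$, be closed and convex with $C:=\bigcap_{i\in I}C_i\neq\emptyset$, and assume that for each $i\in I$ we have $C_i=\operatorname{Fix}U_i$ for some cutter operator $U_i\colon\mathcal H\to\mathcal H$. Let $\varepsilon>0$ and, for each $k=0,1,2,\ldots$, let $\lambda_k\in[0,\infty)$ and $\alpha_k\in[\varepsilon,2-\varepsilon]$. Let the sequence $\{x^k\}_{k=0}^\infty$ be defined by the outer approximation method $$x^0\in\mathcal H;\qquad x^{k+1}:=R_k(x^k-\lambda_kFx^k),\qquad k=0,1,2,\ldots,$$ $$R_k:=\operatorname{Id}+\alpha_k(P_{H_k}-\operatorname{Id}),\qquad H_k:=\{z\in\mathcal H\mid\langle z-T_kx^k,\,x^k-T_kx^k\rangle\le0\},$$ and for every $k=0,1,2,\ldots$ let $T_k\colon\mathcal H\to\mathcal H$ be defined either by a simultaneous algorithmic operator $$T_k:=\sum_{i\in I_k}\omega_i^kU_i$$ or by a composition algorithmic operator $$T_k:=\tfrac12\Bigl(\operatorname{Id}+\prod_{i\in I_k}U_i\Bigr),$$ where $I_k\subseteq I$, $\sum_{i\in I_k}\omega_i^k=1$ and $0<\varepsilon\le\omega_i^k\le1$. Then: (a) The sequence $\{x^k\}_{k=0}^\infty$ is bounded. (b) Moreover, if $\lim_{k\to\infty}\lambda_k=0$, $U_i$ is boundedly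 regular for every $i\in I$, the family $\{C_i\mid i\in I\}$ is boundedly regular, and there is an integer $s\ge1$ such that $I=I_{k-s+1}\cup\ldots\cup I_k$ for all $k\ge s$, then $\lim_{k\to\infty}d(x^k,C)=0$. (c) If, in addition to the assumptions in (b), $\sum_{k=0}^\infty\lambda_k=\infty$, then the sequence $\{x^k\}_{k=0}^\infty$ converges in norm to the unique solution of VI($F$, $C$).
   Context: $\langle\cdot,\cdot\rangle$ and $\|\cdot\|$ are the inner product and induced norm of $\mathcal H$; $\operatorname{Id}$ is the identity operator. $F$ is $L$-Lipschitz continuous ($L>0$) if $\|Fx-Fy\|\le L\|x-y\|$ for all $x,y$, and $\alpha$-strongly monotone ($\alpha>0$) if $\langle Fx-Fy,x-y\rangle\ge\alpha\|x-y\|^2$ for all $x,y$. VI($F$, $C$) is the problem: find $x^*\in C$ such that $\langle Fx^*,z-x^*\rangle\ge0$ for all $z\in C$; under the assumptions on $F$ and $C$ it has a unique solution. For $U\colon\mathcal H\to\mathcal H$, $\operatorname{Fix}U:=\{z\in\mathcal H\mid Uz=z\}$. $U$ is a cutter if $\operatorname{Fix}U\ne\emptyset$ and $\langle z-Ux,x-Ux\rangle\le0$ for all $x\in\mathcal H$ and all $z\in\operatorname{Fix}U$. For a nonempty closed convex set $D$, $P_D$ is the metric projection onto $D$ and $d(x,D)=\|P_Dx-x\|$. The symbol $\prod_{i\in I_k}U_i$ denotes the composition of the operators $U_i$, $i\in I_k$, each taken once, in a prescribed order of $I_k$. Bounded regularity of an operator: $U$ is boundedly regular if for any bounded sequence $\{y^k\}_{k=0}^\infty\subseteq\mathcal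 H$, $\lim_k\|Uy^k-y^k\|=0$ implies $\lim_kd(y^k,\operatorname{Fix}U)=0$. Bounded regularity of a family: $\{C_i\mid i\in I\}$ (closed convex sets with nonempty intersection $C$) is boundedly regular if for any bounded sequence $\{y^k\}_{k=0}^\infty\subseteq\mathcal H$, $\lim_k\max_{i\in I}d(y^k,C_i)=0$ implies $\lim_kd(y^k,C)=0$.
   Formalization: Part (a) is proved only under the added condition limsup λ_k < 2α/L² (which holds whenever λ_k → 0); for arbitrary λ_k in [0,∞) it is false, e.g. H = ℝ, F = U_1 = Id, λ_k = 3 gives x^{k+1} = −2x^k. Parts (b) and (c) are as stated. *)

(* Defs.v *)
From HB Require Import structures.
From mathcomp Require Import all_boot all_order all_algebra.
From mathcomp Require Import all_classical all_reals all_analysis.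
Import Order.TTheory GRing.Theory Num.Theory.
Import numFieldNormedType.Exports.

Set Implicit Arguments.
Unset Strict Implicit.
Unset Printing Implicit Defensive.

Local Open Scope classical_set_scope.
Local Open Scope ring_scope.

(* A real Hilbert space is a complete normed module H over R together with a
   positive definite symmetric form inducing its norm. *)
Definition induces_norm (R : realType) (H : normedModType R)
    (dot : {dot H for (@idfun R)}) : Prop :=
  forall x : H, dot x x = `|x| ^+ 2.

Definition strongly_monotone (R : realType) (H : normedModType R)
    (dot : {dot H for (@idfun R)}) (alpha : R) (F : H -> H) : Prop :=
  forall x y : H, alpha * `|x - y| ^+ 2 <= dot (F x - F y) (x - y).

Definition VI_solution (R : realType) (H : normedModType R)
    (dot : {dot H for (@idfun R)}) (F : H -> H) (C : set H) (xs : H) : Prop :=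
  C xs /\ forall z : H, C z -> 0 <= dot (F xs) (z - xs).

Definition Fix (T : Type) (U : T -> T) : set T := [set z | U z = z].

Definition cutter (R : realType) (H : normedModType R)
    (dot : {dot H for (@idfun R)}) (U : H -> H) : Prop :=
  Fix U !=set0 /\
  forall x z : H, Fix U z -> dot (z - U x) (x - U x) <= 0.

(* The nearest point exists and is unique when D is a nonempty closed convex
   subset of a Hilbert space; the value is unspecified if there is none. *)
Definition metric_proj (R : realType) (H : normedModType R) (D : set H)
    (x : H) : H :=
  get [set p | D p /\ forall z : H, D z -> `|x - p| <= `|x - z|].

Definition dist (R : realType) (H : normedModType R) (x : H) (D : set H) : R :=
  `|metric_proj D x - x|.

Definition boundedly_regular_op (R : realType) (H : normedModType R)
    (U : H -> H) : Prop :=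
  forall y : nat -> H, bounded_fun y ->
    `|U (y k) - y k| @[k --> \oo] --> (0 : R) ->
    dist (y k) (Fix U) @[k --> \oo] --> (0 : R).

Definition boundedly_regular_family (R : realType) (H : normedModType R)
    (m : nat) (C : 'I_m -> set H) : Prop :=
  forall y : nat -> H, bounded_fun y ->
    \big[Num.max/0]_(i < m) dist (y k) (C i) @[k --> \oo] --> (0 : R) ->
    dist (y k) (\bigcap_i C i) @[k --> \oo] --> (0 : R).

Definition simultaneous_op (R : realType) (H : normedModType R) (m : nat)
    (eps : R) (U : 'I_m -> H -> H) (J : {set 'I_m}) (T : H -> H) : Prop :=
  exists w : 'I_m -> R,
    [/\ \sum_(i in J) w i = 1,
        forall i, i \in J -> eps <= w i <= 1 &
        forall y, T y = \sum_(i in J) w i *: U i y].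

(* s lists J without repetition, in the order in which the operators are
   composed. *)
Definition composition_op (R : realType) (H : normedModType R) (m : nat)
    (U : 'I_m -> H -> H) (J : {set 'I_m}) (T : H -> H) : Prop :=
  exists s : seq 'I_m,
    [/\ uniq s, s =i J &
        forall y, T y = 2^-1 *: (y + (\big[comp/idfun]_(i <- s) U i) y)].

Definition outer_halfspace (R : realType) (H : normedModType R)
    (dot : {dot H for (@idfun R)}) (T : H -> H) (x : H) : set H :=
  [set z | dot (z - T x) (x - T x) <= 0].

Definition relaxed_proj (R : realType) (H : normedModType R) (a : R)
    (D : set H) (y : H) : H :=
  y + a *: (metric_proj D y - y).

(* limsup u < b. Nonnegative step sizes alone do not give bounded iterates: if
   F and every U_i are the identity and every step size is 3, then
   x^{k+1} = - 2 x^k. Boundedness is therefore asserted under this condition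
   with b = 2 alpha / L^2, which holds whenever the step sizes tend to 0. *)
Definition eventually_below (R : realType) (u : nat -> R) (b : R) : Prop :=
  exists2 c : R, c < b & \forall k \near \oo, u k <= c.

(* Main.v *)
Require Import Defs.
From mathcomp Require Import all_boot all_order all_algebra.
From mathcomp Require Import all_classical all_reals all_analysis.
From mathcomp Require Import ring lra.
Import Order.TTheory GRing.Theory Num.Theory.
Import numFieldNormedType.Exports.
Local Open Scope classical_set_scope.
Local Open Scope ring_scope.

(** The idea is to follow the distance [d_k] of [x k] to the intersection [C]
    of the fixed point sets.

    Each half-space contains [C]: for [z] in [C] a cutter [V] satisfies
    [<z - x, V x - x> >= |V x - x|^2], which passes to convex combinations by
    Jensen's inequality, and which for the average of [Id] and a composition [S]
    amounts to [|S x - z| <= |x - z|] ([algorithmic_op_halfspace]). Relaxed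
    projections being strongly quasi-nonexpansive, with
    [y = x k - lambda k F (x k)] it follows that
    [|x k.+1 - z|^2 <= |y - z|^2 - eps^2 dist y (H_k)^2] ([fejer_step]).

    Boundedness: for steps below some [c < 2 alpha / L^2] the map
    [Id - lambda F] shrinks distances by a factor [1 - O(lambda)] while it moves
    [z] by [lambda |F z|] only; a large enough ball around [z] is therefore
    never left ([iterates_bounded]).

    Distance to [C]: when the steps tend to 0, [y] and [x k] merge, so [d_k^2]
    decreases by [eps^2 dist y (H_k)^2] up to an error [e_k] that tends to 0.
    These errors are not summable in general. Regularity supplies what is
    missing, in a form uniform on balls ([regular_on_balls]): if every residual
    in a window of length [s] is small then the iterates hardly move in it, each
    [C_i] is approached at some index of it, and thus [d_k] is small
    ([window_dist_lt]). So a large [d_k] drops by a fixed amount in each window,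
    and [d_k] tends to 0 ([windowed_descent_cvg0]).

    Norm convergence: for the solution [xs], which exists because
    [P_C (Id - mu F)] is a contraction for [mu = alpha / L^2], strong
    monotonicity gives
    [|x k.+1 - xs|^2 <= (1 - 2 alpha lambda k) |x k - xs|^2 + lambda k b_k]
    with [b_k = 2 |F xs| d_k + O(lambda k)]: the variational inequality bounds
    [<F xs, x k - xs>] from below by [- |F xs| d_k]. As [b_k] tends to 0 and the
    [lambda k] have infinite sum, [|x k - xs|] tends to 0
    ([contracting_recursion_cvg0]). *)

Set Implicit Arguments.
Unset Strict Implicit.

(** * Inner product identities *)

Section InnerProduct.
Context (R : realType) (H : normedModType R).
Context (dot : {dot H for (@idfun R)}) (dotE : induces_norm dot).
Implicit Types u v w : H.

Lemma dotC u v : dot u v = dot v u.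
Proof. by rewrite hermC expr0 mul1r. Qed.

Lemma dotDl u v w : dot (u + v) w = dot u w + dot v w.
Proof. exact: linearDl. Qed.

Lemma dotNl u v : dot (- u) v = - dot u v.
Proof. exact: linearNl. Qed.

Lemma dotBl u v w : dot (u - v) w = dot u w - dot v w.
Proof. exact: linearBl. Qed.

Lemma dotZl a u v : dot (a *: u) v = a * dot u v.
Proof. exact: linearZl_LR. Qed.

Lemma dotDr u v w : dot w (u + v) = dot w u + dot w v.
Proof. exact: linearDr. Qed.

Lemma dotBr u v w : dot w (u - v) = dot w u - dot w v.
Proof. exact: linearBr. Qed.

Lemma dotZr a u v : dot v (a *: u) = a * dot v u.
Proof. exact: linearZr_LR. Qed.

Lemma dot_sumr (I : finType) (P : pred I) (v : I -> H) u :
  dot u (\sum_(i | P i) v i) = \sum_(i | P i) dot u (v i).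
Proof. exact: linear_sumr. Qed.

Lemma sqr_normD u v : `|u + v| ^+ 2 = `|u| ^+ 2 + 2 * dot u v + `|v| ^+ 2.
Proof. rewrite -!dotE !(dotDl, dotDr) (dotC v u); ring. Qed.

Lemma sqr_normB u v : `|u - v| ^+ 2 = `|u| ^+ 2 - 2 * dot u v + `|v| ^+ 2.
Proof. rewrite -!dotE !(dotBl, dotBr) (dotC v u); ring. Qed.

Lemma sqr_normZ a u : `|a *: u| ^+ 2 = a ^+ 2 * `|u| ^+ 2.
Proof. by rewrite normrZ exprMn real_normK ?num_real. Qed.

(** Cauchy-Schwarz, from [| |v| u - |u| v |^2 >= 0]. *)
Lemma dot_le_norm u v : dot u v <= `|u| * `|v|.
Proof.
have [->|u0] := eqVneq u 0; first by rewrite -(scale0r 0) dotZl mul0r mulr_ge0.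
have [->|v0] := eqVneq v 0; first by rewrite -(scale0r 0) dotZr mul0r mulr_ge0.
have uv0 : 0 < `|u| * `|v| by rewrite mulr_gt0 ?normr_gt0.
have := sqr_ge0 (`| `|v| *: u - `|u| *: v |).
rewrite sqr_normB !sqr_normZ dotZl dotZr => h.
rewrite -subr_ge0 -(pmulr_rge0 _ uv0); nra.
Qed.

Lemma dot_ge_norm u v : - (`|u| * `|v|) <= dot u v.
Proof. by have := dot_le_norm (- u) v; rewrite dotNl normrN; lra. Qed.

Lemma parallelogram u v :
  `|u + v| ^+ 2 + `|u - v| ^+ 2 = 2 * `|u| ^+ 2 + 2 * `|v| ^+ 2.
Proof. by rewrite sqr_normD sqr_normB; ring. Qed.

End InnerProduct.

(** * Metric projections *)

Section Projection.
Context (R : realType) (H : normedModType R).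
Context (dot : {dot H for (@idfun R)}) (dotE : induces_norm dot).
Implicit Types (u v w x y z : H) (D : set H).

Lemma convex_setE D x y t : convex_set D -> D x -> D y ->
  0 <= t <= 1 -> D (t *: x + (1 - t) *: y).
Proof.
move=> cD Dx Dy /andP[t0 t1].
have /set_mem := cD x y (Itv01 t0 t1) (mem_set Dx) (mem_set Dy).
by [].
Qed.

(** Completeness of [H] enters the theory of projections only through the
    existence of nearest points. With this existence as the hypothesis on [D],
    all the estimates live in an arbitrary inner product space. *)
Definition proximinal D : Prop :=
  forall x, exists p, D p /\ forall z, D z -> `|x - p| <= `|x - z|.

(** A minimizing sequence is Cauchy: by the parallelogram law two points of [D]
    that nearly attain the infimum are close, since their midpoint, which is
    in [D], cannot do better than the infimum. *)
Lemma closed_convex_proximinal D :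
  (forall S : set_system H, ProperFilter S -> cauchy S -> cvg S) ->
  closed D -> convex_set D -> D !=set0 -> proximinal D.
Proof.
move=> completeH clD cD [z0 Dz0] x.
pose E := [set `|x - z| ^+ 2 | z in D].
have Elb : has_lbound E by exists 0 => _ [z _ <-]; exact: sqr_ge0.
have Einf : has_inf E by split => //; exists (`|x - z0| ^+ 2), z0.
pose d := inf E.
have dle z : D z -> d <= `|x - z| ^+ 2 by move=> Dz; apply: ge_inf => //; exists z.
have /choice[z_ z_P] n : exists z, D z /\ `|x - z| ^+ 2 < d + harmonic n.
  have n0 : 0 < harmonic n :> R by rewrite /= invr_gt0 ltr0n.
  by have [_ [z Dz <-] zlt] := inf_adherent n0 Einf; exists z.
have zclose n k : (n <= k)%N -> `|z_ n - z_ k| ^+ 2 <= 4 * harmonic n.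
  move=> nk; have [Dn nlt] := z_P n; have [Dk klt] := z_P k.
  have Dm : D (2^-1 *: z_ n + (1 - 2^-1) *: z_ k) by apply: convex_setE => //; lra.
  have kn : harmonic k <= harmonic n :> R by rewrite /= lef_pV2 ?posrE ?ltr0n// ler_nat.
  have mid : x - (2^-1 *: z_ n + (1 - 2^-1) *: z_ k) =
             2^-1 *: ((x - z_ n) + (x - z_ k)).
    rewrite (_ : 1 - 2^-1 = 2^-1 :> R); last by lra.
    rewrite addrACA -opprD -scalerDr scalerBr; congr (_ - _).
    by rewrite scalerDr -scalerDl (_ : 2^-1 + 2^-1 = 1 :> R) ?scale1r//; lra.
  have midd : d <= (2^-1) ^+ 2 * `|(x - z_ n) + (x - z_ k)| ^+ 2.
    by have := dle _ Dm; rewrite mid sqr_normZ.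
  have diff : `|(x - z_ n) - (x - z_ k)| = `|z_ n - z_ k|.
    by rewrite opprB addrC addrA subrK distrC.
  have := parallelogram dotE (x - z_ n) (x - z_ k); rewrite diff.
  by move: nlt klt kn midd; rewrite (_ : 2^-1 ^+ 2 = 4^-1 :> R); [lra|field].
have zc : cvgn z_.
  apply: completeH; apply: cauchy_exP => e e0.
  have e40 : 0 < e ^+ 2 / 4 by rewrite divr_gt0 ?exprn_gt0.
  have [N _ hN] := near_infty_natSinv_lt (PosNum e40).
  have {}hN : harmonic N < e ^+ 2 / 4 by exact: (hN N (leqnn N)).
  exists (z_ N); exists N => // n /= Nn; rewrite -ball_normE /=.
  rewrite -(@ltr_pXn2r _ 2)// ?nnegrE// ?ltW//.
  by have := zclose _ _ Nn; move: hN; lra.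
have [p zp] := (cvg_ex _).1 zc; exists p; split.
  by apply: (closed_cvg _ clD _ _ zp); apply: nearW => n; case: (z_P n).
move=> z Dz; rewrite -(@ler_pXn2r _ 2)// ?nnegrE//.
apply: le_trans (dle _ Dz).
have l1 : `|x - z_ n| ^+ 2 @[n --> \oo] --> `|x - p| ^+ 2.
  by apply: cvgM; apply: cvg_norm; apply: cvgB => //; exact: cvg_cst.
have l2 : d + harmonic n @[n --> \oo] --> d.
  rewrite -[X in _ --> X]addr0; apply: cvgD; first exact: cvg_cst.
  exact: cvg_harmonic.
by apply: (ler_cvg_to l1 l2); apply: nearW => n; case: (z_P n) => _ /ltW.
Qed.

Section OnProximinalSet.
Context (D : set H) (cD : convex_set D) (pD : proximinal D).

Lemma metric_projP x :
  D (metric_proj D x) /\ forall z, D z -> `|x - metric_proj D x| <= `|x - z|.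
Proof. exact: (getPex (pD x)). Qed.

Lemma metric_proj_in x : D (metric_proj D x).
Proof. by case: (metric_projP x). Qed.

Lemma dist_le x z : D z -> dist x D <= `|x - z|.
Proof. by move=> Dz; rewrite /dist distrC; apply: (metric_projP x).2. Qed.

Lemma dist_Lipschitz x y : dist x D <= `|x - y| + dist y D.
Proof.
apply: le_trans (dist_le x (metric_proj_in y)) _.
by rewrite [dist _ _]distrC ler_distD.
Qed.

(** Moving from the projection [p] towards [z] by a small step [t] stays in [D]
    and changes the squared distance to [x] by
    [- 2 t <x - p, z - p> + t^2 |z - p|^2]. If the inner product [c] were
    positive then [t = c / (|z - p|^2 + c)] would bring it below the minimum. *)
Lemma metric_proj_obtuse x z : D z ->
  dot (x - metric_proj D x) (z - metric_proj D x) <= 0.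
Proof.
move=> Dz; have [Dp pP] := metric_projP x; set p := metric_proj D x in Dp pP *.
rewrite leNgt; apply/negP => c0; set c := dot _ _ in c0.
set b := `|z - p| ^+ 2; have b0 : 0 <= b by exact: sqr_ge0.
have bc0 : 0 < b + c by rewrite ltr_wpDl.
pose t := c / (b + c).
have t0 : 0 < t by rewrite divr_gt0.
have t1 : t <= 1 by rewrite ler_pdivrMr// mul1r lerDr.
have tE : t * (b + c) = c by rewrite /t divfK// gt_eqF.
have /pP : D (t *: z + (1 - t) *: p) by apply: convex_setE => //; rewrite ltW.
rewrite -(@ler_pXn2r _ 2)// ?nnegrE//.
rewrite (_ : x - (t *: z + _) = (x - p) - t *: (z - p)); last first.
  by rewrite scalerBl scale1r scalerBr !opprD !opprK !addrA; rewrite (addrAC x).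
rewrite [leRHS](sqr_normB dotE) dotZr sqr_normZ -/c -/b.
by move: tE t0 c0; nra.
Qed.

Lemma metric_proj_nonexpansive x y :
  `|metric_proj D x - metric_proj D y| <= `|x - y|.
Proof.
have := metric_proj_obtuse x (metric_proj_in y).
have := metric_proj_obtuse y (metric_proj_in x).
set p := metric_proj D x; set q := metric_proj D y => h1 h2.
have h : `|p - q| ^+ 2 <= dot (x - y) (p - q).
  rewrite -dotE; move: h1 h2.
  by rewrite !(dotBl, dotBr) (dotC dot q p); lra.
have := dot_le_norm dotE (x - y) (p - q).
have [->//|pq] := eqVneq `|p - q| 0.
have pq0 : 0 < `|p - q| by rewrite lt_neqAle eq_sym pq normr_ge0.
by move=> h3; rewrite -(ler_pM2r pq0) -expr2; lra.
Qed.

(** The obtuse angle at [p = P_D y] gives [|p - y|^2 <= <z - y, p - y>], and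
    expanding [|y - z + a (p - y)|^2] leaves a gain of [a (2 - a) |p - y|^2]. *)
Lemma relaxed_proj_le a y z : 0 <= a -> D z ->
  `|relaxed_proj a D y - z| ^+ 2 <=
  `|y - z| ^+ 2 - a * (2 - a) * dist y D ^+ 2.
Proof.
move=> a0 Dz; have := metric_proj_obtuse y Dz.
rewrite /relaxed_proj /dist; set p := metric_proj D y => h.
rewrite addrAC [leLHS](sqr_normD dotE) sqr_normZ dotZr.
have : `|p - y| ^+ 2 <= - dot (y - z) (p - y).
  rewrite -dotE; move: h; rewrite !(dotBl, dotBr).
  by rewrite (dotC dot y p) (dotC dot y z) (dotC dot p z); lra.
by move=> k; have := ler_wpM2l a0 k; lra.
Qed.

Lemma relaxed_proj_displacement a y : 0 <= a <= 2 ->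
  `|relaxed_proj a D y - y| <= 2 * dist y D.
Proof.
move=> /andP[a0 a2]; rewrite /relaxed_proj addrC addKr normrZ ger0_norm//.
exact: ler_wpM2r.
Qed.

End OnProximinalSet.

Lemma closed_halfspace u n : closed [set z | dot (z - u) n <= 0].
Proof.
apply: (@preimage_closed _ _ (fun z => dot (z - u) n) [set r | r <= 0]);
  last exact: closed_le.
move=> /= z _; apply/cvgrPdist_le => e e0; near=> w.
rewrite -[dot (z - u) n - _]dotBl opprB addrA subrK ler_norml.
have : `|z - w| * `|n| <= e.
  rewrite (@le_trans _ _ (`|z - w| * (1 + `|n|)))//.
    by rewrite ler_wpM2l// lerDr.
  rewrite -ler_pdivlMr; last by rewrite ltr_pwDl.
  near: w; apply: cvgr_dist_le => //; rewrite divr_gt0// ltr_pwDl//.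
have := dot_le_norm dotE (z - w) n; have := dot_ge_norm dotE (z - w) n; lra.
Unshelve. all: by end_near. Qed.

Lemma convex_halfspace u n : convex_set [set z | dot (z - u) n <= 0].
Proof.
move=> x y t; rewrite !inE /= => hx hy.
have -> : conv t (x : convex_lmodType H) y = t%:num *: x + (1 - t%:num) *: y by [].
move: hx hy; rewrite !dotBl dotDl !dotZl => hx hy.
have t0 : 0 <= t%:num by [].
have t1 : t%:num <= 1 :> R by [].
by nra.
Qed.

End Projection.

(** * Strongly monotone variational inequalities *)

Section StronglyMonotone.
Context (R : realType) (H : normedModType R).
Context (dot : {dot H for (@idfun R)}) (dotE : induces_norm dot).
Context (F : H -> H) (L alpha : R).
Context (L_gt0 : 0 < L) (alpha_gt0 : 0 < alpha).
Context (F_lip : L.-lipschitz F) (F_mono : strongly_monotone dot alpha F).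
Implicit Types (x y z : H) (D : set H) (mu : R).

Lemma lipschitz_le x y : `|F x - F y| <= L * `|x - y|.
Proof. by apply: (@F_lip (x, y)). Qed.

Lemma gradient_step_le mu x y : 0 <= mu ->
  `|(x - mu *: F x) - (y - mu *: F y)| ^+ 2 <=
  (1 - mu * (2 * alpha - mu * L ^+ 2)) * `|x - y| ^+ 2.
Proof.
move=> mu0.
have -> : (x - mu *: F x) - (y - mu *: F y) = (x - y) - mu *: (F x - F y).
  by rewrite scalerBr !opprB addrACA [RHS]addrACA [in RHS](addrC (- y)).
rewrite [leLHS](sqr_normB dotE) sqr_normZ dotZr dotC.
have mono := ler_wpM2l mu0 (F_mono x y).
have lip : `|F x - F y| ^+ 2 <= L ^+ 2 * `|x - y| ^+ 2.
  by rewrite -exprMn lerXn2r ?nnegrE ?lipschitz_le// mulr_ge0// ltW.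
have := ler_wpM2l (sqr_ge0 mu) lip; move: mono; lra.
Qed.

(** The step [alpha / L^2] minimizes [1 - mu (2 alpha - mu L^2)], whose value
    there is [1 - (alpha / L)^2]. *)
Lemma gradient_step_contraction : exists q : {nonneg R}, q%:num < 1 /\
  forall x y, `|(x - (alpha / L ^+ 2) *: F x) - (y - (alpha / L ^+ 2) *: F y)|
    <= q%:num * `|x - y|.
Proof.
have L2 : 0 < L ^+ 2 by rewrite exprn_gt0.
(* [alpha > L] is possible when [H] is trivial, hence the maximum with 0. *)
pose r := Num.max 0 (1 - (alpha / L) ^+ 2).
have r0 : 0 <= r by rewrite le_max lexx.
have r1 : r < 1 by rewrite gt_max ltr01/= gtrBl exprn_gt0// divr_gt0.
exists (NngNum (sqrtr_ge0 r)); split; first by rewrite /= -sqrtr1 ltr_sqrt.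
move=> x y /=; rewrite -(@ler_pXn2r _ 2)// ?nnegrE ?mulr_ge0// exprMn sqr_sqrtr//.
apply: le_trans (gradient_step_le _ _ _) _; first by rewrite divr_ge0// ltW.
rewrite ler_wpM2r// ?sqr_ge0// le_max; apply/orP; right.
rewrite le_eqVlt; apply/orP; left; apply/eqP; field.
exact: lt0r_neq0.
Qed.

Lemma VI_solution_unique D x y :
  VI_solution dot F D x -> VI_solution dot F D y -> x = y.
Proof.
move=> [Dx xP] [Dy yP]; apply/eqP; rewrite -subr_eq0 -normr_eq0.
rewrite -[_ == 0](@expf_eq0 _ _ 2) -[_ == 0]orFb eq_le sqr_ge0 andbT.
rewrite -(pmulr_rle0 _ alpha_gt0) (le_trans (F_mono x y))//.
by have := xP y Dy; have := yP x Dx; rewrite !(dotBl, dotBr); lra.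
Qed.

End StronglyMonotone.

(** The solutions of VI(F, D) are the fixed points of the contraction
    [P_D (Id - mu F)] with [mu = alpha / L^2]. *)
Lemma VI_solution_ex (R : realType) (H : completeNormedModType R)
    (dot : {dot H for (@idfun R)}) (dotE : induces_norm dot)
    (F : H -> H) (L alpha : R) (D : set H) :
  0 < L -> 0 < alpha -> L.-lipschitz F -> strongly_monotone dot alpha F ->
  convex_set D -> proximinal D -> exists xs, VI_solution dot F D xs.
Proof.
move=> L0 al0 Flip Fmono cD pD; pose mu := alpha / L ^+ 2.
have mu0 : 0 < mu by rewrite divr_gt0// exprn_gt0.
pose G (x : H) := metric_proj D (x - mu *: F x).
have [q [q1 qP]] := gradient_step_contraction dotE L0 al0 Flip Fmono.
have contrG : is_contraction (totalfun G).
  exists q; split=> // -[x y] _ /=.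
  by apply: le_trans (metric_proj_nonexpansive dotE cD pD _ _) (qP x y).
have [p _ pE] := banach_fixed_point contrG closedT (ex_intro _ 0 I).
have {}pE : metric_proj D (p - mu *: F p) = p by [].
exists p; split; first by rewrite -pE; exact: metric_proj_in.
move=> z Dz; have := metric_proj_obtuse dotE cD pD (p - mu *: F p) Dz.
by rewrite pE addrAC subrr sub0r dotNl dotZl oppr_le0 pmulr_rge0.
Qed.

(** * Regularity on balls *)

Section UniformRegularity.
Context (R : realType) (H : normedModType R).

Lemma bounded_seqP (y : nat -> H) :
  bounded_fun y <-> exists M : R, forall k, `|y k| <= M.
Proof.
have PF : ProperFilter (globally [set: nat]).
  exact: (@globally_properfilter _ _ 0%N).
split=> [/(ex_bound y)[M yM]|[M yM]]; first by exists M => k; exact: yM.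
by apply/(ex_bound y); exists M => k _; exact: yM.
Qed.

(** Sequential regularity is uniform on balls: points [y k] of the ball with
    [f (y k) <= 1 / (k + 1)] and [g (y k) >= delta] would form a bounded
    sequence that contradicts it. *)
Lemma regular_on_balls (f g : H -> R) (z : H) (rho delta : R) :
  (forall y, 0 <= f y) ->
  (forall y : nat -> H, bounded_fun y -> f (y k) @[k --> \oo] --> (0 : R) ->
     g (y k) @[k --> \oo] --> (0 : R)) ->
  0 < delta ->
  exists2 eta : R, 0 < eta &
    forall y, `|y - z| <= rho -> f y <= eta -> g y < delta.
Proof.
move=> f0 reg delta0; apply: contrapT => nex.
have /choice[y yP] k : exists y, [/\ `|y - z| <= rho, f y <= harmonic k & delta <= g y].
  apply: contrapT => nexy; apply: nex; exists (harmonic k).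
    by rewrite /= invr_gt0.
  move=> y yz fy; rewrite ltNge; apply/negP => gy.
  by apply: nexy; exists y.
have ybnd : bounded_fun y.
  apply/bounded_seqP; exists (rho + `|z|) => k; have [yz _ _] := yP k.
  by rewrite -[y k](subrK z) (le_trans (ler_normD _ _))// lerD2r.
have fy0 : f (y k) @[k --> \oo] --> (0 : R).
  apply: (@squeeze_cvgr _ _ _ _ (fun=> 0) harmonic).
  - by apply: nearW => k; rewrite f0; case: (yP k).
  - exact: cvg_cst.
  - exact: cvg_harmonic.
have /cvgr0Pnorm_lt/(_ _ delta0)[N _ gN] := reg y ybnd fy0.
have := gN N (leqnn N) => /=; have [_ _] := yP N.
by rewrite ltNge => dg; rewrite (le_trans dg (ler_norm _)).
Qed.

End UniformRegularity.

(** * Cutters, convex combinations and averaged compositions *)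

Section Cutters.
Context (R : realType) (H : normedModType R).
Context (dot : {dot H for (@idfun R)}) (dotE : induces_norm dot).
Implicit Types (x y z : H).

Lemma cutter_formE x z t :
  dot (z - t) (x - t) = `|t - x| ^+ 2 - dot (z - x) (t - x).
Proof. by rewrite -dotE !(dotBl, dotBr) (dotC dot t x); ring. Qed.

Lemma cutter_dot_ge (V : H -> H) x z : cutter dot V -> Fix V z ->
  `|V x - x| ^+ 2 <= dot (z - x) (V x - x).
Proof. by move=> [_ cV] Vz; have := cV x z Vz; rewrite cutter_formE subr_le0. Qed.

Lemma cutter_sqr_le (V : H -> H) x z : cutter dot V -> Fix V z ->
  `|V x - z| ^+ 2 + `|V x - x| ^+ 2 <= `|x - z| ^+ 2.
Proof.
move=> cV Vz; have := cutter_dot_ge x cV Vz.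
have := sqr_normD dotE (V x - x) (x - z).
by rewrite addrA subrK -[z - x]opprB dotNl (dotC dot (x - z)); lra.
Qed.

(** Jensen's inequality, from [2 <V, v_i> <= |V|^2 + |v_i|^2] with
    [V = \sum_i w_i v_i]. *)
Lemma sqr_norm_convex_sum (I : finType) (A : {set I}) (w : I -> R) (v : I -> H) :
  \sum_(i in A) w i = 1 -> (forall i, i \in A -> 0 <= w i) ->
  `|\sum_(i in A) w i *: v i| ^+ 2 <= \sum_(i in A) w i * `|v i| ^+ 2.
Proof.
move=> w1 w0; set V := \sum_(i in A) _.
have : 2 * `|V| ^+ 2 <= \sum_(i in A) w i * (`|V| ^+ 2 + `|v i| ^+ 2).
  rewrite -[in leLHS]dotE [in X in dot _ X]/V dot_sumr mulr_sumr.
  apply: ler_sum => i iA.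
  rewrite dotZr mulrCA ler_wpM2l ?w0//.
  by have := sqr_ge0 (`|V - v i|); rewrite (sqr_normB dotE); lra.
rewrite (eq_bigr (fun i => w i * `|V| ^+ 2 + w i * `|v i| ^+ 2)); last first.
  by move=> i _; rewrite mulrDr.
by rewrite big_split/= -mulr_suml w1 mul1r; lra.
Qed.

Lemma averageB x y : 2^-1 *: (x + y) - x = 2^-1 *: (y - x).
Proof.
have hx : x = 2^-1 *: x + 2^-1 *: x.
  by rewrite -scalerDl (_ : 2^-1 + 2^-1 = 1 :> R) ?scale1r//; lra.
by rewrite scalerDr [X in _ - X = _]hx opprD addrACA subrr add0r scalerBr.
Qed.

Section Family.
Context (m : nat) (U : 'I_m -> H -> H) (U_cutter : forall i, cutter dot (U i)).
Context (z : H) (Uz : forall i, Fix (U i) z).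

Lemma simultaneous_op_dot_ge (eps : R) (J : {set 'I_m}) (T : H -> H) x (w : 'I_m -> R) :
  0 < eps -> \sum_(i in J) w i = 1 -> (forall i, i \in J -> eps <= w i <= 1) ->
  T x = \sum_(i in J) w i *: U i x ->
  [/\ `|T x - x| ^+ 2 <= dot (z - x) (T x - x) &
      forall i, i \in J -> eps * `|U i x - x| ^+ 2 <= dot (z - x) (T x - x)].
Proof.
move=> eps0 w1 wb Tx.
have w0 i : i \in J -> 0 <= w i by case/wb/andP => /(lt_le_trans eps0)/ltW.
have TxB : T x - x = \sum_(i in J) w i *: (U i x - x).
  under eq_bigr do rewrite scalerBr.
  by rewrite sumrB -scaler_suml w1 scale1r Tx.
have sum_le : \sum_(i in J) w i * `|U i x - x| ^+ 2 <= dot (z - x) (T x - x).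
  rewrite TxB dot_sumr; apply: ler_sum => i iJ.
  by rewrite dotZr ler_wpM2l ?w0//; exact: cutter_dot_ge.
split=> [|i iJ].
  by apply: le_trans sum_le; rewrite TxB; exact: sqr_norm_convex_sum.
apply: le_trans sum_le; rewrite (bigD1 i)//= ler_wpDr//.
  by apply: sumr_ge0 => j /andP[jJ _]; rewrite mulr_ge0 ?w0// sqr_ge0.
by rewrite ler_wpM2r ?sqr_ge0//; case/andP: (wb i iJ).
Qed.

(** Each factor of a product of cutters decreases the squared distance to [z]
    by at least the square of its displacement. So a bound [kappa^2] on the
    total decrease bounds every displacement along the trajectory by [kappa],
    and the point at which [U i] gets evaluated stays near [x]. *)
Lemma composition_trajectory (s : seq 'I_m) x :
  `|(\big[comp/idfun]_(i <- s) U i) x - z| <= `|x - z| /\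
  forall kappa : R, 0 <= kappa ->
    `|x - z| ^+ 2 - `|(\big[comp/idfun]_(i <- s) U i) x - z| ^+ 2 <= kappa ^+ 2 ->
    `|(\big[comp/idfun]_(i <- s) U i) x - x| <= (size s)%:R * kappa /\
    forall i, i \in s -> exists y, [/\ `|y - z| <= `|x - z|,
      `|x - y| <= (size s)%:R * kappa & `|U i y - y| <= kappa].
Proof.
elim: s => [|i s [IHn IH]].
  by rewrite big_nil /=; split=> // kappa _ _; rewrite subrr normr0 mul0r.
rewrite big_cons /=; set y := (\big[comp/idfun]_(i <- s) U i) x in IHn IH *.
have Uy := cutter_sqr_le y (U_cutter i) (Uz i).
have Uyn : `|U i y - z| <= `|y - z|.
  by rewrite -(@ler_pXn2r _ 2)// ?nnegrE//; have := sqr_ge0 `|U i y - y|; lra.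
split; first exact: le_trans IHn.
move=> kappa k0 dec.
have yz : `|y - z| ^+ 2 <= `|x - z| ^+ 2 by rewrite lerXn2r ?nnegrE.
have [|IH1 IH2] := IH kappa k0; first by have := sqr_ge0 `|U i y - y|; lra.
have Uyk : `|U i y - y| <= kappa.
  by rewrite -(@ler_pXn2r _ 2)// ?nnegrE//; lra.
rewrite -[(size s).+1%:R]natr1 mulrDl mul1r; split.
  by rewrite (le_trans (ler_distD y _ _))// addrC lerD.
move=> j; rewrite inE => /predU1P[->|/IH2[y' [y'z y'x Uy']]].
  by exists y; split=> //; rewrite distrC ler_wpDr.
by exists y'; split=> //; rewrite ler_wpDr.
Qed.

Lemma algorithmic_op_halfspace (eps : R) (J : {set 'I_m}) (T : H -> H) x :
  0 < eps -> simultaneous_op eps U J T \/ composition_op U J T ->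
  outer_halfspace dot T x z.
Proof.
move=> eps0; rewrite /outer_halfspace /= cutter_formE subr_le0.
case=> [[w [w1 wb TE]]|[s [_ _ TE]]].
  by have [] := simultaneous_op_dot_ge eps0 w1 wb (TE x).
have [Sx _] := composition_trajectory s x; rewrite TE.
set S := (\big[_/_]_(_ <- _) _) x in Sx *.
have {}Sx : `|S - z| ^+ 2 <= `|x - z| ^+ 2 by rewrite lerXn2r ?nnegrE.
rewrite averageB.
rewrite sqr_normZ dotZr (_ : 2^-1 ^+ 2 = 4^-1 :> R); last by field.
move: Sx; have := sqr_normD dotE (S - x) (x - z).
by rewrite addrA subrK -[z - x]opprB dotNl (dotC dot (x - z)); lra.
Qed.


(** Both kinds of operators turn a small residual [T x - x] into small
    displacements of the [U i], at [x] for a simultaneous operator and, for a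
    composition, at points near [x]. The operators [U i] need not be
    continuous, so only the distances to their fixed point sets, which are
    1-Lipschitz, can be carried back from these points to [x]. *)
Lemma algorithmic_op_regular (eps rho delta : R) :
  (forall i, proximinal (Fix (U i))) -> (forall i, boundedly_regular_op (U i)) ->
  0 < eps -> 0 <= rho -> 0 < delta ->
  exists2 tau : R, 0 < tau &
    forall (J : {set 'I_m}) (T : H -> H) x,
      simultaneous_op eps U J T \/ composition_op U J T ->
      `|x - z| <= rho -> `|T x - x| <= tau ->
      forall i, i \in J -> dist x (Fix (U i)) < delta.
Proof.
move=> pU regU eps0 rho0 delta0.
have delta20 : 0 < delta / 2 by rewrite divr_gt0.
have /choice[eta etaP] i : exists eta : R, 0 < eta /\
    forall y, `|y - z| <= rho -> `|U i y - y| <= eta -> dist y (Fix (U i)) < delta / 2.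
  have [//|//|eta eta0 etaP] := @regular_on_balls _ _ (fun y => `|U i y - y|)
    (fun y => dist y (Fix (U i))) z rho (delta / 2) _ (@regU i).
  by exists eta.
(* [kappa] bounds single displacements: it makes every [U i] regular up to
   [delta / 2], and at most [m] of them add up to [delta / 2]. *)
pose kappa : R := Num.min (delta / 2 / m.+1%:R) (\big[Num.min/1]_i eta i).
have kappa0 : 0 < kappa.
  rewrite lt_min divr_gt0//=; apply: lt_bigmin => // i _.
  by case: (etaP i).
have kappa_eta i : kappa <= eta i by rewrite ge_min bigmin_le orbT.
have kappa_delta : m%:R * kappa <= delta / 2.
  have : kappa <= delta / 2 / m.+1%:R by rewrite ge_min lexx.
  rewrite ler_pdivlMr// -[m.+1%:R]natr1; move: kappa0; nra.
(* The residual controls [eps kappa^2] for simultaneous operators and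
   [kappa^2] for compositions; [tau] serves both. *)
pose e1 : R := Num.min eps 1.
have e10 : 0 < e1 by rewrite lt_min eps0 ltr01.
have [e1eps e11] : e1 <= eps /\ e1 <= 1 by rewrite !ge_min !lexx orbT.
have k20 : 0 < kappa ^+ 2 by rewrite exprn_gt0.
pose tau := e1 * kappa ^+ 2 / (4 * (1 + rho)).
have rho40 : 0 < 4 * (1 + rho) by rewrite mulr_gt0// ltr_wpDr.
have tau0 : 0 < tau by rewrite divr_gt0// mulr_gt0.
have tauE : 4 * rho * tau <= e1 * kappa ^+ 2.
  have : tau * (4 * (1 + rho)) = e1 * kappa ^+ 2 by rewrite /tau divfK// gt_eqF.
  by move: tau0; lra.
exists tau => // J T x TJ xz Tx i iJ.
have xzTx : `|x - z| * `|T x - x| <= rho * tau by rewrite ler_pM.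
case: TJ => [[w [w1 wb TE]]|[s [us sJ TE]]].
  have [_ /(_ i iJ) Ui] := simultaneous_op_dot_ge eps0 w1 wb (TE x).
  have half : delta / 2 < delta by rewrite ltr_pdivrMr// ltr_pMr// ltr1n.
  apply: lt_trans half.
  apply: (etaP i).2 => //; apply: le_trans (kappa_eta i).
  rewrite -(@ler_pXn2r _ 2)// ?nnegrE ?(ltW kappa0)// -(ler_pM2l eps0).
  apply: le_trans Ui _; apply: le_trans (dot_le_norm dotE _ _) _.
  rewrite distrC; apply: le_trans xzTx _.
  have rt0 : 0 <= rho * tau by rewrite mulr_ge0// ltW.
  by have := ler_wpM2r (ltW k20) e1eps; move: tauE rt0; lra.
have [_ /(_ kappa (ltW kappa0))] := composition_trajectory s x.
set S := (\big[_/_]_(_ <- _) _) x => traj.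
have [|_ /(_ i)] := traj.
  have TS : `|T x - x| = 2^-1 * `|S - x|.
    by rewrite TE averageB normrZ ger0_norm// invr_ge0.
  have := sqr_normD dotE (S - x) (x - z); rewrite addrA subrK.
  have := dot_ge_norm dotE (S - x) (x - z); have := sqr_ge0 `|S - x|.
  have ek : e1 * kappa ^+ 2 <= kappa ^+ 2 by rewrite ler_piMl// ltW.
  by move: xzTx tauE ek; rewrite TS; lra.
rewrite sJ => /(_ iJ)[y [yz xy Uy]].
apply: le_lt_trans (dist_Lipschitz (pU i) x y) _.
have ydist := (etaP i).2 y (le_trans yz xz) (le_trans Uy (kappa_eta i)).
have sm : (size s)%:R * kappa <= m%:R * kappa.
  rewrite ler_wpM2r ?(ltW kappa0)// ler_nat.
  by have := max_card (mem s); rewrite (card_uniqP us) card_ord.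
by move: kappa_delta xy ydist; lra.
Qed.

End Family.
End Cutters.

(** * Two convergence criteria for real sequences *)

Section RealSequences.
Context (R : realType).
Implicit Types (D g e b lambda : nat -> R).

(** If [D] stays above [delta / 2] then each window of length [s] contains an
    index at which [g] removes at least [eta], while the errors of that window
    add at most [eta / 2]. So a value [D n >= delta] forces
    [D (n - q s) >= delta + q eta / 2] for all [q], against the bound on [D]. *)
Lemma windowed_descent_cvg0 D g e (B : R) (s : nat) :
  (forall k, 0 <= D k <= B) -> (forall k, 0 <= g k) ->
  e k @[k --> \oo] --> (0 : R) ->
  (forall k, D k.+1 <= D k + e k - g k) ->
  (forall delta : R, 0 < delta -> exists2 eta : R, 0 < eta &
    \forall k \near \oo, (forall j, (k <= j < k + s)%N -> g j < eta) ->
      D k < delta) ->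
  D k @[k --> \oo] --> (0 : R).
Proof.
move=> DB g0 e0 Dstep Dwin.
suff main (delta : R) : 0 < delta -> \forall k \near \oo, `|D k| < delta.
  exact/cvgr0Pnorm_lt.
move=> delta0.
have delta20 : 0 < delta / 2 by rewrite divr_gt0.
have [eta eta0 [N1 _ win]] := Dwin _ delta20.
pose E : R := Num.min (delta / 2) (eta / 2) / s.+1%:R.
have E0 : 0 < E by rewrite divr_gt0// lt_min delta20 divr_gt0.
have [sE1 sE2] : s%:R * E <= delta / 2 /\ s%:R * E <= eta / 2.
  suff : s%:R * E <= Num.min (delta / 2) (eta / 2) by rewrite le_min => /andP[].
  rewrite /E mulrCA ger_pMr; last by rewrite lt_min delta20 divr_gt0.
  by rewrite ler_pdivrMr// mul1r ler_nat.
have [N2 _ eE] : \forall k \near \oo, e k <= E.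
  move/cvgr0Pnorm_lt/(_ _ E0) : e0; apply: filterS => k /ltW.
  exact: le_trans (ler_norm _).
pose N := maxn N1 N2.
have DtE t k : (N <= k)%N -> D (k + t)%N <= D k + t%:R * E /\
    forall j, (k <= j < k + t)%N -> D (k + t)%N + g j <= D k + t%:R * E.
  move=> Nk; elim: t => [|t [IH1 IH2]].
    by rewrite addn0 mul0r addr0; split=> // j; case: ltngtP.
  have Ekt : e (k + t)%N <= E.
    apply: eE => /=; rewrite (leq_trans _ (leq_addr _ _))//.
    by rewrite (leq_trans _ Nk)// leq_maxr.
  have := Dstep (k + t)%N; have := g0 (k + t)%N.
  rewrite addnS -[t.+1%:R]natr1 mulrDl mul1r.
  move=> gp st; split=> [|j /andP[kj]]; first by lra.
  rewrite ltnS leq_eqVlt => /predU1P[->|jt]; first by lra.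
  by have := IH2 j; rewrite kj jt => /(_ isT); lra.
have Dhigh k : (N <= k)%N -> delta <= D (k + s)%N -> D (k + s)%N + eta / 2 <= D k.
  move=> Nk Ds; have [D1 D2] := DtE s k Nk.
  have /contra_not h := win k (leq_trans (leq_maxl _ _) Nk).
  have /existsNP[j /not_implyP[kj /negP]] : ~ forall j, (k <= j < k + s)%N -> g j < eta.
    by apply: h; apply/negP; rewrite -leNgt; lra.
  by rewrite -leNgt => gj; have := D2 j kj; lra.
have Dmany q k : (N <= k)%N -> delta <= D (k + q * s)%N ->
    delta + q%:R * (eta / 2) <= D k.
  elim: q k => [|q IH] k Nk; first by rewrite mul0n addn0 mul0r addr0.
  rewrite mulSn addnA => /(IH _ (leq_trans Nk (leq_addr _ _))) Dks.
  have q0 : 0 <= q%:R * (eta / 2) by rewrite mulr_ge0// ltW// divr_gt0.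
  have Ds : delta <= D (k + s)%N by lra.
  by have := Dhigh k Nk Ds; rewrite -[q.+1%:R]natr1; lra.
pose q := (Num.truncn (B / (eta / 2))).+1.
have qB : B < q%:R * (eta / 2) by rewrite -ltr_pdivrMr ?divr_gt0// truncnS_gt.
exists (N + q * s)%N => // n /= Nn; have /andP[Dn0 _] := DB n.
rewrite ger0_norm// ltNge; apply/negP => dD.
have /andP[_] := DB (n - q * s)%N.
have qn : (q * s <= n)%N by rewrite (leq_trans _ Nn)// leq_addl.
have := Dmany q (n - q * s)%N; rewrite subnK// leq_subRL// addnC => /(_ Nn dD).
by move: qB; lra.
Qed.

(** As long as [s >= delta] the sequence decreases by at least a multiple of
    [lambda k], which cannot go on since the sum of the [lambda k] diverges;
    and once [s k <= delta] it stays so, [s k.+1] being bounded by a convex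
    combination of [s k] and [b k / c]. *)
Lemma contracting_recursion_cvg0 (s lambda b : nat -> R) (c : R) :
  0 < c -> (forall k, 0 <= s k) -> (forall k, 0 <= lambda k) ->
  lambda k @[k --> \oo] --> (0 : R) -> series lambda k @[k --> \oo] --> +oo%R ->
  b k @[k --> \oo] --> (0 : R) ->
  (forall k, s k.+1 <= (1 - c * lambda k) * s k + lambda k * b k) ->
  s k @[k --> \oo] --> (0 : R).
Proof.
move=> c0 s0 l0 lim_l div_l lim_b step.
suff main (delta : R) : 0 < delta -> \forall k \near \oo, `|s k| <= delta.
  exact/cvgr0Pnorm_le.
move=> delta0.
have cd0 : 0 < c * delta / 2 by rewrite divr_gt0// mulr_gt0.
have ic0 : 0 < c^-1 by rewrite invr_gt0.
have [N1 _ bN] : \forall k \near \oo, b k <= c * delta / 2.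
  move/cvgr0Pnorm_lt/(_ _ cd0) : lim_b; apply: filterS => k /ltW.
  exact: le_trans (ler_norm _).
have [N2 _ lN] : \forall k \near \oo, lambda k <= c^-1.
  move/cvgr0Pnorm_lt/(_ _ ic0) : lim_l; apply: filterS => k /ltW.
  exact: le_trans (ler_norm _).
pose N := maxn N1 N2.
have stepN k : (N <= k)%N -> [/\ 0 <= lambda k, c * lambda k <= 1 &
    s k.+1 <= (1 - c * lambda k) * s k + lambda k * (c * delta / 2)].
  move=> Nk; split => //.
    rewrite mulrC -ler_pdivlMr// div1r; apply: lN.
    by rewrite /= (leq_trans (leq_maxr _ _) Nk).
  apply: le_trans (step k) _; rewrite lerD2l ler_wpM2l//.
  by apply: bN; rewrite /= (leq_trans (leq_maxl _ _) Nk).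
have [k0 Nk0 sk0] : exists2 k, (N <= k)%N & s k <= delta.
  apply: contrapT => nex.
  have high t : delta < s (N + t)%N.
    by rewrite ltNge; apply/negP => ?; apply: nex; exists (N + t)%N; rewrite ?leq_addr.
  have dec t : s (N + t)%N +
      c * delta / 2 * (series lambda (N + t)%N - series lambda N) <= s N.
    elim: t => [|t IH]; first by rewrite addn0 subrr mulr0 addr0.
    have [lt0 _ st] := stepN (N + t)%N (leq_addr _ _).
    have cl0 : 0 <= c * lambda (N + t)%N by rewrite mulr_ge0// ltW.
    have := ler_wpM2l cl0 (ltW (high t)).
    rewrite addnS /series /= big_nat_recr//=.
    by move: st IH; rewrite /series/=; lra.
  have /cvgryPge/(_ (series lambda N + (s N + 1) / (c * delta / 2)))[M _ MP] := div_l.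
  have := MP (N + M)%N (leq_addl _ _); rewrite /= -lerBrDl ler_pdivrMr// mulrC => big.
  by have := dec M; have := s0 (N + M)%N; lra.
exists k0 => // k /= k0k; rewrite ger0_norm//.
rewrite -(subnKC k0k); elim: (k - k0)%N => [|t IH]; first by rewrite addn0.
have [lt0 cl1 st] := stepN (k0 + t)%N (leq_trans Nk0 (leq_addr _ _)).
have cl0 : 0 <= 1 - c * lambda (k0 + t)%N by rewrite subr_ge0.
have := ler_wpM2l cl0 IH.
have : 0 <= lambda (k0 + t)%N * (c * delta / 2) by rewrite mulr_ge0// ltW.
by rewrite addnS; move: st; lra.
Qed.

End RealSequences.

(** * The outer approximation method *)

Section OuterApproximation.
Context (R : realType) (H : normedModType R).
Context (completeH : forall S : set_system H, ProperFilter S -> cauchy S -> cvg S).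
Context (dot : {dot H for (@idfun R)}) (dotE : induces_norm dot).
Implicit Types (y z : H).

Lemma mem_bigcup_nat (I : finType) (A : nat -> {set I}) (a b : nat) (i : I) :
  i \in (\bigcup_(a <= j < b) A j)%SET -> exists2 j, (a <= j < b)%N & i \in A j.
Proof.
rewrite big_nat; apply: (big_ind (fun B : {set I} => i \in B ->
  exists2 j, (a <= j < b)%N & i \in A j)).
- by rewrite inE.
- by move=> B1 B2 h1 h2; rewrite inE => /orP[/h1|/h2].
- by move=> j ab ij; exists j.
Qed.

Lemma near_ball_bounded (x : nat -> H) z (B : R) :
  (\forall k \near \oo, `|x k - z| <= B) -> bounded_fun x.
Proof.
move=> [N _ xB]; apply/bounded_seqP.
exists (\sum_(j < N) `|x j| + (`|B| + `|z|)) => k.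
have S0 : 0 <= \sum_(j < N) `|x j| by exact: sumr_ge0.
have [Nk|kN] := leqP N k.
  rewrite ler_wpDl// -[x k](subrK z) (le_trans (ler_normD _ _))// lerD2r.
  by rewrite (le_trans (xB k Nk))// ler_norm.
rewrite ler_wpDr ?addr_ge0// (bigD1 (Ordinal kN))//= lerDl.
exact: sumr_ge0.
Qed.

Lemma sqr_cvg0 (u : nat -> R) :
  u k ^+ 2 @[k --> \oo] --> (0 : R) -> u k @[k --> \oo] --> (0 : R).
Proof.
move=> u2; apply/cvgr0Pnorm_lt => e e0.
have e20 : 0 < e ^+ 2 by rewrite exprn_gt0.
move/cvgr0Pnorm_lt/(_ _ e20) : u2; apply: filterS => k.
by rewrite normrX ltr_pXn2r// nnegrE// ltW.
Qed.

Section Halfspace.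
Context (T : H -> H) (x : H).
Let Hx := outer_halfspace dot T x.

Lemma outer_halfspace_convex : convex_set Hx.
Proof. exact: convex_halfspace. Qed.

Lemma outer_halfspace_proximinal : proximinal Hx.
Proof.
apply: (closed_convex_proximinal dotE completeH).
- exact: closed_halfspace.
- exact: outer_halfspace_convex.
- by exists (T x); rewrite /Hx /outer_halfspace /= subrr -(scale0r 0) dotZl mul0r.
Qed.

(** [T x] is on the boundary of the half-space and [x - T x] is normal to it,
    so no point of the half-space is closer to [x] than [T x]. *)
Lemma residual_le_outer_halfspace w : Hx w -> `|T x - x| <= `|x - w|.
Proof.
rewrite /Hx /outer_halfspace /= => Hw; rewrite -(@ler_pXn2r _ 2)// ?nnegrE//.
have := sqr_normB dotE (w - T x) (x - T x).
rewrite opprB addrA subrK distrC [`|T x - x|]distrC.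
by have := sqr_ge0 `|w - T x|; lra.
Qed.

Lemma residual_le_dist y : `|T x - x| <= `|y - x| + dist y Hx.
Proof.
have := residual_le_outer_halfspace (metric_proj_in outer_halfspace_proximinal y).
move/le_trans; apply; apply: le_trans (ler_distD y _ _) _.
by rewrite [`|x - y|]distrC lerD2l /dist distrC.
Qed.

End Halfspace.

Context (F : H -> H) (L alpha : R) (L_gt0 : 0 < L) (alpha_gt0 : 0 < alpha).
Context (F_lip : L.-lipschitz F) (F_mono : strongly_monotone dot alpha F).
Context (m : nat) (U : 'I_m -> H -> H) (U_cutter : forall i, cutter dot (U i)).
Context (pU : forall i, proximinal (Fix (U i))).
Let C : set H := \bigcap_i Fix (U i).
Context (pC : proximinal C).
Context (eps : R) (eps_gt0 : 0 < eps).
Context (lambda : nat -> R) (lambda_ge0 : forall k, 0 <= lambda k).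
Context (a : nat -> R) (a_bnd : forall k, eps <= a k <= 2 - eps).
Context (J : nat -> {set 'I_m}) (T : nat -> H -> H).
Context (T_def : forall k,
  simultaneous_op eps U (J k) (T k) \/ composition_op U (J k) (T k)).
Context (x : nat -> H).
Let y k := x k - lambda k *: F (x k).
Let Hs k := outer_halfspace dot (T k) (x k).
Context (x_rec : forall k, x k.+1 = relaxed_proj (a k) (Hs k) (y k)).

Lemma C_sub_halfspace k z : C z -> Hs k z.
Proof.
move=> Cz; apply: (algorithmic_op_halfspace dotE U_cutter _ (x k) eps_gt0 (T_def k)).
by move=> i; exact: Cz.
Qed.

Lemma fejer_step k z : C z ->
  `|x k.+1 - z| ^+ 2 <= `|y k - z| ^+ 2 - eps ^+ 2 * dist (y k) (Hs k) ^+ 2.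
Proof.
move=> /(C_sub_halfspace k) Hz; have /andP[a1 a2] := a_bnd k; rewrite x_rec.
have a0 : 0 <= a k by rewrite (le_trans (ltW eps_gt0)).
have := relaxed_proj_le dotE (@outer_halfspace_convex _ _)
  (outer_halfspace_proximinal _ _) (y k) a0 Hz.
move/le_trans; apply; rewrite lerD2l lerN2 ler_wpM2r ?sqr_ge0//.
by move: eps_gt0 a1 a2; nra.
Qed.

Lemma fejer_step_le k z : C z -> `|x k.+1 - z| <= `|y k - z|.
Proof.
move=> /(fejer_step k) h; rewrite -(@ler_pXn2r _ 2)// ?nnegrE//.
apply: le_trans h _; rewrite gerBl mulr_ge0 ?sqr_ge0//.
Qed.

(** For steps below [c < 2 alpha / L^2] the gradient step contracts the distance
    to [z] by [1 - lambda delta / 2] up to the error [lambda |F z|], so the ball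
    around [z] of radius [2 |F z| / delta], once enlarged to contain one
    iterate, is never left. *)
Lemma iterates_bounded :
  eventually_below lambda (2 * alpha / L ^+ 2) -> bounded_fun x.
Proof.
move=> [c cL [N _ lc]].
have L2 : 0 < L ^+ 2 by rewrite exprn_gt0.
have [z [Cz _]] := pC 0.
have c0 : 0 <= c by apply: le_trans (lambda_ge0 N) (lc N (leqnn N)).
(* [lambda <= c], so the second term of the minimum keeps [lambda delta] below
   1 and the factor [1 - lambda delta / 2] positive. *)
pose delta : R := Num.min (2 * alpha - c * L ^+ 2) (1 + c)^-1.
have c10 : 0 < 1 + c by rewrite ltr_wpDr.
have delta0 : 0 < delta.
  by rewrite lt_min invr_gt0 c10 andbT subr_gt0 -ltr_pdivlMr.
have [d1 d2] : delta <= 2 * alpha - c * L ^+ 2 /\ delta * (1 + c) <= 1.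
  by rewrite -ler_pdivlMr// div1r !ge_min !lexx orbT.
pose B := Num.max `|x N - z| (2 * `|F z| / delta).
have B0 : 0 <= B by rewrite le_max normr_ge0.
have FB : `|F z| <= delta * B / 2.
  have : 2 * `|F z| / delta <= B by rewrite le_max lexx orbT.
  by rewrite ler_pdivrMr//; lra.
apply: (@near_ball_bounded _ z B); exists N => // k /= Nk.
rewrite -(subnKC Nk); elim: (k - N)%N => [|t IH]; first by rewrite addn0 le_max lexx.
rewrite addnS; apply: le_trans (fejer_step_le _ Cz) _.
have := lc (N + t)%N (leq_addr _ _); have := lambda_ge0 (N + t)%N.
set l := lambda _ => l0 /= lec.
have ld : l * delta <= 1.
  by apply: le_trans d2; rewrite mulrC ler_wpM2l ?(ltW delta0)// ler_wpDl.
have v2 := gradient_step_le dotE L_gt0 F_lip F_mono (x (N + t)%N) z l0.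
set v := _ - (z - _) in v2.
have vB : `|v| <= (1 - l * delta / 2) * B.
  have h0 : 0 <= 1 - l * delta / 2 by lra.
  apply: (@le_trans _ _ ((1 - l * delta / 2) * `|x (N + t)%N - z|));
    last by rewrite ler_wpM2l.
  rewrite -(@ler_pXn2r _ 2)// ?nnegrE ?mulr_ge0// exprMn.
  apply: le_trans v2 _; rewrite ler_wpM2r ?sqr_ge0//.
  have : l * delta <= l * (2 * alpha - l * L ^+ 2).
    by rewrite ler_wpM2l// (le_trans d1)// lerD2l lerN2 ler_wpM2r// ltW.
  have := sqr_ge0 (l * delta / 2); lra.
have -> : y (N + t)%N - z = v - l *: F z.
  by rewrite /v opprB addrA [RHS]addrAC addrK.
apply: le_trans (ler_normB _ _) _; rewrite normrZ ger0_norm//.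
by have := ler_wpM2l l0 FB; lra.
Qed.

Section VanishingSteps.
Context (lambda_cvg0 : lambda k @[k --> \oo] --> (0 : R)).

Lemma bounded_iterates : bounded_fun x.
Proof.
apply: iterates_bounded.
have c0 : 0 < alpha / L ^+ 2 by rewrite divr_gt0// exprn_gt0.
exists (alpha / L ^+ 2); first by rewrite -mulrA ltr_pMl// ltr1n.
move/cvgr0Pnorm_lt/(_ _ c0) : lambda_cvg0; apply: filterS => k /ltW.
exact: le_trans (ler_norm _).
Qed.

Lemma bounded_around z : exists rho : R, 0 <= rho /\ forall k, `|x k - z| <= rho.
Proof.
have /bounded_seqP[M xM] := bounded_iterates.
exists (M + `|z|); split; first by rewrite addr_ge0// (le_trans _ (xM 0%N)).
by move=> k; rewrite (le_trans (ler_normB _ _))// lerD2r.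
Qed.

Lemma bounded_gradients : exists M : R, 0 <= M /\ forall k, `|F (x k)| <= M.
Proof.
have [rho [rho0 xrho]] := bounded_around 0.
exists (L * rho + `|F 0|); split; first by rewrite addr_ge0// mulr_ge0// ltW.
move=> k; rewrite -[F (x k)](subrK (F 0)) (le_trans (ler_normD _ _))// lerD2r.
by rewrite (le_trans (lipschitz_le F_lip _ _))// ler_wpM2l// ltW.
Qed.

Lemma gradient_displacement (M : R) k : `|F (x k)| <= M -> `|y k - x k| <= lambda k * M.
Proof.
move=> FM; rewrite /y addrC addKr normrN normrZ ger0_norm//.
exact: ler_wpM2l.
Qed.

Section Regular.
Context (U_reg : forall i, boundedly_regular_op (U i)).
Context (C_reg : boundedly_regular_family (fun i => Fix (U i))).
Context (s : nat) (s_gt0 : (0 < s)%N) (J_cover : forall k, (s <= k)%N ->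
  (\bigcup_(k - s + 1 <= j < k.+1) J j)%SET = [set: 'I_m]%SET).

(** If the half-spaces are all close to the iterates of a window of length
    [s], then so are all the [Fix (U i)], every [i] being active once in the
    window during which the iterates hardly move; hence [C] is close too. *)
Lemma window_dist_lt (delta : R) : 0 < delta ->
  exists2 eta : R, 0 < eta & \forall k \near \oo,
    (forall j, (k <= j < k + s)%N -> dist (y j) (Hs j) < eta) ->
    dist (x k) C < delta.
Proof.
move=> delta0; have [z [Cz _]] := pC 0.
have [rho [rho0 xrho]] := bounded_around z.
have [M [M0 FM]] := bounded_gradients.
pose f w := \big[Num.max/0]_(i < m) dist w (Fix (U i)).
have f0 w : 0 <= f w by apply/bigmax_geP; left.
have [eta eta0 etaP] :=
  @regular_on_balls _ _ f (fun w => dist w C) z rho delta f0 C_reg delta0.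
have eta20 : 0 < eta / 2 by rewrite divr_gt0.
have [tau tau0 tauP] := algorithmic_op_regular dotE U_cutter (fun i => Cz i I)
  pU U_reg eps_gt0 rho0 eta20.
(* A step moves an iterate by at most [3 nu]: [nu] for the gradient and [2 nu]
   for the relaxed projection. A window of [s] steps moves it by [eta / 2]. *)
pose nu : R := Num.min (tau / 2) (eta / 6 / s.+1%:R).
have nu0 : 0 < nu by rewrite lt_min !divr_gt0.
have nu_tau : 2 * nu <= tau.
  have : nu <= tau / 2 by rewrite ge_min lexx.
  by lra.
have nu_eta : s%:R * (3 * nu) <= eta / 2.
  have : nu <= eta / 6 / s.+1%:R by rewrite ge_min lexx orbT.
  by rewrite ler_pdivlMr// -[s.+1%:R]natr1; move: nu0; lra.
have [N1 _ lN] : \forall k \near \oo, lambda k * M <= nu.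
  have : lambda k * M @[k --> \oo] --> (0 : R).
    by rewrite -(mul0r M); apply: cvgM => //; exact: cvg_cst.
  move/cvgr0Pnorm_lt/(_ _ nu0); apply: filterS => k /ltW.
  exact: le_trans (ler_norm _).
exists nu => //; exists (maxn N1 1) => // k /=; rewrite geq_max => /andP[N1k k1] win.
have yx j : (k <= j)%N -> `|y j - x j| <= nu.
  move=> kj; rewrite (le_trans (gradient_displacement (FM j)))// lN//=.
  exact: leq_trans N1k kj.
have move_le t : (t <= s)%N -> `|x k - x (k + t)%N| <= t%:R * (3 * nu).
  elim: t => [|t IH] ts; first by rewrite addn0 subrr normr0 mul0r.
  have kt : (k <= k + t < k + s)%N by rewrite leq_addr ltn_add2l.
  have disp : `|x (k + t).+1 - y (k + t)%N| <= 2 * dist (y (k + t)%N) (Hs (k + t)%N).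
    rewrite x_rec; apply: relaxed_proj_displacement.
    by have /andP[a1 a2] := a_bnd (k + t); move: eps_gt0; lra.
  have := ler_distD (x (k + t)%N) (x k) (x (k + t).+1).
  have := ler_distD (y (k + t)%N) (x (k + t)%N) (x (k + t).+1).
  have := win _ kt; have := yx _ (leq_addr t k); have := IH (ltnW ts).
  rewrite [`|x (k + t)%N - y _|]distrC [`|y _ - x (k + t).+1|]distrC.
  by rewrite addnS -[t.+1%:R]natr1 mulrDl mul1r; move: disp; lra.
apply: etaP; first exact: xrho.
apply: bigmax_le; first exact: ltW.
move=> i _.
have ks : (k + s.-1).+1 = (k + s)%N by rewrite -addnS prednK.
have sk : (s <= k + s.-1)%N by rewrite -ltnS ks -[X in (X < _)%N]add0n ltn_add2r.
have : i \in (\bigcup_(k + s.-1 - s + 1 <= j < (k + s.-1).+1) J j)%SET.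
  by rewrite J_cover ?inE.
rewrite addn1 -subSn// ks addnK => /mem_bigcup_nat[j /andP[kj js] ij].
have jx : `|x k - x j| <= eta / 2.
  have jk : (j - k <= s)%N by rewrite leq_subLR ltnW.
  have := move_le _ jk; rewrite subnKC// => /le_trans; apply; apply: le_trans nu_eta.
  by rewrite ler_wpM2r ?ler_nat// mulr_ge0// ltW.
have Tj : `|T j (x j) - x j| <= tau.
  apply: le_trans (residual_le_dist _ _ (y j)) _; apply: le_trans nu_tau.
  have := win j; rewrite kj js => /(_ isT).
  by have := yx j kj; lra.
have := tauP _ _ _ (T_def j) (xrho j) Tj i ij.
by have := dist_Lipschitz (pU i) (x k) (x j); move: jx; lra.
Qed.

Lemma dist_cvg0 : dist (x k) C @[k --> \oo] --> (0 : R).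
Proof.
have [z [Cz _]] := pC 0.
have [rho [rho0 xrho]] := bounded_around z.
have [M [M0 FM]] := bounded_gradients.
have dist0 w D : 0 <= dist w D by exact: normr_ge0.
have dist_rho k : dist (x k) C <= rho by apply: le_trans (dist_le pC _ Cz) (xrho k).
apply: sqr_cvg0.
pose e k := lambda k * (2 * rho * M + lambda k * M ^+ 2).
pose g k := eps ^+ 2 * dist (y k) (Hs k) ^+ 2.
apply: (@windowed_descent_cvg0 _ _ g e (rho ^+ 2) s).
- by move=> k; rewrite sqr_ge0/= lerXn2r ?nnegrE ?dist0.
- by move=> k; rewrite mulr_ge0// sqr_ge0.
- rewrite -(mul0r (2 * rho * M + 0 * M ^+ 2)); apply: cvgM => //.
  apply: cvgD; first exact: cvg_cst.
  by apply: cvgM => //; exact: cvg_cst.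
- move=> k; set p := metric_proj C (y k).
  have Cp : C p by exact: metric_proj_in.
  have d1 : dist (x k.+1) C ^+ 2 <= dist (y k) C ^+ 2 - g k.
    apply: le_trans (_ : `|x k.+1 - p| ^+ 2 <= _).
      by rewrite lerXn2r ?nnegrE ?dist0//; exact: dist_le.
    by have := fejer_step k Cp; rewrite [dist (y k) C]distrC.
  have d2 : dist (y k) C <= dist (x k) C + lambda k * M.
    rewrite addrC; apply: le_trans (dist_Lipschitz pC _ (x k)) _.
    by rewrite lerD2r gradient_displacement.
  have d3 : dist (y k) C ^+ 2 <= (dist (x k) C + lambda k * M) ^+ 2.
    by rewrite lerXn2r ?nnegrE ?addr_ge0 ?dist0// mulr_ge0.
  have lM : 0 <= lambda k * M by rewrite mulr_ge0.
  have := ler_wpM2l lM (dist_rho k); move: d1 d3; rewrite /e; lra.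
move=> delta delta0.
have [|nu nu0] := @window_dist_lt (Num.min delta 1).
  by rewrite lt_min delta0 ltr01.
move=> winP; exists (eps ^+ 2 * nu ^+ 2); first by rewrite mulr_gt0// exprn_gt0.
apply: filterS winP => k winP gk.
have : dist (x k) C < Num.min delta 1.
  apply: winP => j /gk; rewrite /g ltr_pM2l ?exprn_gt0// ltr_pXn2r ?nnegrE ?dist0//.
  exact: ltW.
rewrite lt_min => /andP[d1 d2]; apply: le_lt_trans d1.
by rewrite expr2 ler_piMl ?dist0// ltW.
Qed.

(** The projection steps decrease the distance to the solution [xs], which
    leaves [|x - xs - lambda F x|^2]. There strong monotonicity yields the
    factor [1 - 2 alpha lambda], and [<F xs, x - xs> >= - |F xs| dist x C]
    because [xs] solves the variational inequality and [x] is at distance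
    [dist x C] from a point of [C]. *)
Lemma iterates_cvg (xs : H) : series lambda k @[k --> \oo] --> +oo%R ->
  VI_solution dot F C xs -> x k @[k --> \oo] --> xs.
Proof.
move=> div_l [Cxs xsP].
have [M [M0 FM]] := bounded_gradients.
pose b k := 2 * `|F xs| * dist (x k) C + lambda k * M ^+ 2.
have : `|x k - xs| @[k --> \oo] --> (0 : R).
  apply: sqr_cvg0.
  apply: (@contracting_recursion_cvg0 _ _ lambda b (2 * alpha)) => //.
  - by rewrite mulr_gt0.
  - rewrite (_ : 0 = 2 * `|F xs| * 0 + 0 * M ^+ 2); last by rewrite mulr0 mul0r addr0.
    apply: cvgD; first by apply: cvgM; [exact: cvg_cst|exact: dist_cvg0].
    by apply: cvgM => //; exact: cvg_cst.
  move=> k; apply: le_trans (_ : `|y k - xs| ^+ 2 <= _).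
    by rewrite lerXn2r ?nnegrE// fejer_step_le.
  set p := metric_proj C (x k); have Cp : C p by exact: metric_proj_in.
  have l0 := lambda_ge0 k.
  have fxs : - (`|F xs| * dist (x k) C) <= dot (F xs) (x k - xs).
    have -> : x k - xs = (x k - p) + (p - xs) by rewrite addrA subrK.
    rewrite dotDr.
    have := dot_ge_norm dotE (F xs) (x k - p); have := xsP _ Cp.
    by rewrite /dist -/p [`|p - _|]distrC; lra.
  have mono := F_mono (x k) xs; rewrite dotBl in mono.
  have F2 : `|F (x k)| ^+ 2 <= M ^+ 2 by rewrite lerXn2r ?nnegrE.
  rewrite /y addrAC (sqr_normB dotE) sqr_normZ dotZr (dotC dot (x k - xs)).
  have h1 := ler_wpM2l l0 fxs; have h2 := ler_wpM2l l0 mono.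
  have h3 := ler_wpM2l (sqr_ge0 (lambda k)) F2.
  by rewrite /b; lra.
move/cvgr0Pnorm_lt => h; apply/cvgrPdist_lt => e e0.
by have := h e e0; apply: filterS => k; rewrite normr_id distrC.
Qed.

End Regular.
End VanishingSteps.
End OuterApproximation.

Lemma convex_bigcap (R : realType) (H : lmodType R) (I : Type) (C : I -> set H) :
  (forall i, convex_set (C i)) -> convex_set (\bigcap_i C i).
Proof.
move=> cC y z t; rewrite !inE => Cy Cz i _; apply/set_mem.
by apply: cC; rewrite inE; [exact: Cy|exact: Cz].
Qed.

Unset Implicit Arguments.
Set Strict Implicit.

Theorem theorem4p1 (R : realType) (H : completeNormedModType R)
  (dot : {dot H for (@idfun R)}) (dotE : induces_norm dot)
  (F : H -> H) (L alpha : R) (L_gt0 : 0 < L) (alpha_gt0 : 0 < alpha)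
  (F_lip : L.-lipschitz F) (F_mono : strongly_monotone dot alpha F)
  (m : nat) (m_gt0 : (0 < m)%N)
  (C : 'I_m -> set H)
  (C_closed : forall i, closed (C i)) (C_convex : forall i, convex_set (C i))
  (C_neq0 : \bigcap_i C i !=set0)
  (U : 'I_m -> H -> H)
  (U_cutter : forall i, cutter dot (U i)) (C_Fix : forall i, C i = Fix (U i))
  (eps : R) (eps_gt0 : 0 < eps)
  (lambda : nat -> R) (lambda_ge0 : forall k, 0 <= lambda k)
  (a : nat -> R) (a_bnd : forall k, eps <= a k <= 2 - eps)
  (J : nat -> {set 'I_m}) (T : nat -> H -> H)
  (T_def : forall k,
     simultaneous_op eps U (J k) (T k) \/ composition_op U (J k) (T k))
  (x : nat -> H)
  (x_rec : forall k, x k.+1 =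
     relaxed_proj (a k) (outer_halfspace dot (T k) (x k))
       (x k - lambda k *: F (x k))) :
  (eventually_below lambda (2 * alpha / L ^+ 2) -> bounded_fun x) /\
  (lambda k @[k --> \oo] --> (0 : R) ->
   (forall i, boundedly_regular_op (U i)) ->
   boundedly_regular_family C ->
   (exists s : nat, (1 <= s)%N /\ forall k, (s <= k)%N ->
      (\bigcup_(k - s + 1 <= j < k.+1) J j)%SET = [set: 'I_m]%SET) ->
   dist (x k) (\bigcap_i C i) @[k --> \oo] --> (0 : R) /\
   (series lambda k @[k --> \oo] --> +oo%R ->
    exists2 xs : H, unique (VI_solution dot F (\bigcap_i C i)) xs &
      x k @[k --> \oo] --> xs)).
Proof.
have completeH (S : set_system H) : ProperFilter S -> cauchy S -> cvg S.
  by move=> PS; move/cauchy_cvgP.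
have cC : convex_set (\bigcap_i C i) by exact: convex_bigcap.
have pC : proximinal (\bigcap_i C i).
  apply: (closed_convex_proximinal dotE completeH) => //.
  by apply: closed_bigI => i _; exact: C_closed.
have pU i : proximinal (Fix (U i)).
  rewrite -C_Fix; apply: (closed_convex_proximinal dotE completeH) => //.
  by have [z Cz] := C_neq0; exists z; exact: Cz.
have CE : C = (fun i => Fix (U i)) by apply/funext => i; exact: C_Fix.
subst C.
split=> [lambda_below|lambda0 U_reg C_reg [s [s1 J_cover]]].
  exact: (iterates_bounded completeH dotE L_gt0 F_lip F_mono U_cutter
    pC eps_gt0 lambda_ge0 a_bnd T_def x_rec lambda_below).
split=> [|div_l].
  exact: (dist_cvg0 completeH dotE L_gt0 alpha_gt0 F_lip F_mono U_cutter pU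
    pC eps_gt0 lambda_ge0 a_bnd T_def x_rec lambda0 U_reg C_reg s1 J_cover).
have [xs xsP] := VI_solution_ex dotE L_gt0 alpha_gt0 F_lip F_mono cC pC.
exists xs.
  by split=> // ys; exact: (VI_solution_unique alpha_gt0 F_mono xsP).
exact: (iterates_cvg completeH dotE L_gt0 alpha_gt0 F_lip F_mono U_cutter pU
  pC eps_gt0 lambda_ge0 a_bnd T_def x_rec lambda0 U_reg C_reg s1 J_cover div_l xsP).
Qed.
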